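(* Let $n \ge 1$ and $r \ge 1$ be integers. (a) The sum of two $n \times n$ real TN$_r$ Hankel matrices is TN$_r$. (b) The sum of an $n\times n$ real TN$_r$ Hankel matrix and an $n \times n$ real TP$_r$ Hankel matrix is TP$_r$.
   Context: A square matrix $A=(a_{ij})_{1\le i,j\le n}$ is Hankel if $a_{ij}$ depends only on $i+j$. A real matrix is TN$_r$ (totally nonnegative of order $r$) if every minor (determinant of a square submatrix, not necessarily contiguous) of size $\le r$ is nonnegative, and TP$_r$ (totally positive of order $r$) if every minor of size $\le r$ is positive. *)

(* Defs.v *)
From HB Require Import structures.
From mathcomp Require Import all_boot all_order all_algebra.
From mathcomp Require Import reals.

Set Implicit Arguments.
Unset Strict Implicit.
Unset Printing Implicit Defensive.

Import Order.TTheory GRing.Theory Num.Theory.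
Local Open Scope ring_scope.

Definition hankel (R : realType) (n : nat) (A : 'M[R]_n) : Prop :=
  forall i j i' j' : 'I_n, (i + j = i' + j')%N -> A i j = A i' j'.

(* A choice of k rows (or columns) out of n is represented by the strictly
   increasing map enumerating it; in particular it need not be contiguous. *)
Definition strictly_increasing (k n : nat) (f : 'I_k -> 'I_n) : Prop :=
  forall i j : 'I_k, (i < j)%N -> (f i < f j)%N.

Definition totally_nonnegative (R : realType) (r n : nat) (A : 'M[R]_n) : Prop :=
  forall (k : nat) (f g : 'I_k -> 'I_n), (0 < k <= r)%N ->
    strictly_increasing f -> strictly_increasing g ->
    0 <= \det (mxsub f g A).

Definition totally_positive (R : realType) (r n : nat) (A : 'M[R]_n) : Prop :=
  forall (k : nat) (f g : 'I_k -> 'I_n), (0 < k <= r)%N ->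
    strictly_increasing f -> strictly_increasing g ->
    0 < \det (mxsub f g A).

(* Main.v *)
(** Every contiguous square block of a Hankel matrix is symmetric, so TN_r
    (resp. TP_r) makes each contiguous block of size at most r positive
    semidefinite (resp. definite), and these properties are stable under sums.
    Conversely, positive definite blocks have positive determinants, and by
    Fekete's criterion (contiguous minors of size at most r suffice) this gives
    TP_r, which proves (b). Semidefinite blocks do not give TN_r directly: for
    (a), add e times a Hankel matrix all of whose contiguous blocks are positive
    definite, apply the strict case, and let e tend to 0. *)
Require Import Defs.
From HB Require Import structures.
From mathcomp Require Import all_boot all_order all_algebra.
From mathcomp Require Import reals.
From mathcomp Require Import zify ring lra.

Set Implicit Arguments.
Unset Strict Implicit.
Unset Printing Implicit Defensive.

Import Order.TTheory GRing.Theory Num.Theory.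
Local Open Scope ring_scope.

(** * Signed maximal minors and a three-term determinant relation *)

Section SignedMinors.
Variable R : realFieldType.

Definition signed_minors m (M : 'M[R]_(m.+1, m)) : 'rV[R]_m.+1 :=
  \row_i ((-1) ^+ i * \det (row' i M)).

(** Entry [j0] of the product is the Laplace expansion, along its first column, of [M] with a copy
    of column [j0] prepended; the repeated column makes this determinant zero. *)
Lemma signed_minors_ker m (M : 'M[R]_(m.+1, m)) : signed_minors M *m M = 0.
Proof.
apply/matrixP => i0 j0; rewrite !mxE.
pose E := \matrix_(i < m.+1, j < m.+1) oapp (M i) (M i j0) (unlift ord0 j).
have E0 : \det E = 0.
  rewrite -det_tr; apply: (@determinant_alternate _ _ _ ord0 (lift ord0 j0)) => //.
  by move=> i; rewrite !mxE liftK unlift_none.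
rewrite -[RHS]E0 (expand_det_col _ ord0). apply: eq_bigr => i _.
rewrite !mxE unlift_none /= mulrC /cofactor addn0; congr (_ * (_ * \det _)).
by apply/matrixP => u v; rewrite !mxE liftK.
Qed.

(* The left kernel of [N := col' ord0 M] is spanned by the signed minors of [N]
   with its first, respectively last, row deleted. Expressing the signed minors
   of [M] in this basis and reading off entry [p] is a Pluecker relation. *)
Lemma det_row'_interior_gt0 m (M : 'M[R]_(m.+2, m.+1)) (p : 'I_m.+2) :
  (0 < p < m.+1)%N ->
  (forall c i, 0 < \det (row' i (row' c (col' ord0 M)))) ->
  0 < \det (row' ord0 M) -> 0 < \det (row' ord_max M) ->
  0 < \det (row' p M).
Proof.
move=> p_int; set N := col' ord0 M => N_gt0 d0 d1.
pose z := signed_minors M.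
pose u := signed_minors (row' ord_max N).
pose v := signed_minors (row' ord0 N).
have zker : z *m N = 0.
  apply/matrixP => i j; have /matrixP/(_ i (lift ord0 j)) := signed_minors_ker M.
  rewrite [X in X = _ -> _]mxE [X in _ = X -> _]mxE => E; rewrite mxE [RHS]mxE -[RHS]E.
  by apply: eq_bigr => k _; rewrite !mxE.
(* Inserting a zero at position [c] turns a left kernel vector of [row' c N] into one of [N]. *)
pose ext (c : 'I_m.+2) (w : 'rV[R]_m.+1) : 'rV[R]_m.+2 := \row_i oapp (w 0) 0 (unlift c i).
have ext_lift c w i : ext c w 0 (lift c i) = w 0 i by rewrite mxE liftK.
have ext_id c w : ext c w 0 c = 0 by rewrite mxE unlift_none.
have ext_ker c : ext c (signed_minors (row' c N)) *m N = 0.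
  apply/matrixP => i j; have /matrixP/(_ i j) := signed_minors_ker (row' c N).
  rewrite [X in X = _ -> _]mxE [X in _ = X -> _]mxE => E; rewrite mxE [RHS]mxE -[RHS]E ord1.
  rewrite (bigD1_ord c) //= ext_id mul0r add0r.
  by apply: eq_bigr => k _; rewrite ext_lift !mxE.
have p_max : lift ord_max (inord p : 'I_m.+1) = p.
  by apply: val_inj; rewrite /= /bump inordK; lia.
have p_0 : lift ord0 (inord p.-1 : 'I_m.+1) = p.
  by apply: val_inj; rewrite /= /bump inordK; lia.
have max0 : lift ord_max (ord0 : 'I_m.+1) = ord0 by apply: val_inj.
have zmax : lift ord0 (ord_max : 'I_m.+1) = ord_max by apply: val_inj.
have uE i : u 0 i = (-1) ^+ i * \det (row' i (row' ord_max N)) by rewrite mxE.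
have vE i : v 0 i = (-1) ^+ i * \det (row' i (row' ord0 N)) by rewrite mxE.
have zE i : z 0 i = (-1) ^+ i * \det (row' i M) by rewrite mxE.
(* These coefficients cancel the first and the last entry of [w]. The sign in front of [b] is a plus
   because the last index of [v] is one less than that of [z], which flips the parity. *)
pose a := \det (row' ord0 M) / \det (row' ord0 (row' ord_max N)).
pose b := \det (row' ord_max M) / \det (row' ord_max (row' ord0 N)).
pose w := z - a *: ext ord_max u + b *: ext ord0 v.
have wker : w *m N = 0.
  by rewrite mulmxDl mulmxBl -!scalemxAl !ext_ker zker !scaler0 subr0 addr0.
have wE i : w 0 i = z 0 i - a * ext ord_max u 0 i + b * ext ord0 v 0 i.
  by rewrite !mxE.
have w0 : w 0 ord0 = 0.
  rewrite wE ext_id -{2}max0 ext_lift zE uE !expr0 /a.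
  by field; rewrite gt_eqF.
have w1 : w 0 ord_max = 0.
  rewrite wE ext_id -{2}zmax ext_lift zE vE /b /= exprS.
  by field; rewrite gt_eqF.
have w_eq0 i : w 0 i = 0.
  (* With both end entries zero, the inner part of [w] is a left kernel vector of [N] without its
     first and last rows, an invertible square matrix. *)
  pose w' : 'rV[R]_m := \row_k w 0 (lift ord_max (lift ord0 k)).
  have w'0 : w' = 0.
    have U : row' ord0 (row' ord_max N) \in unitmx by rewrite unitmxE unitfE gt_eqF.
    apply: (can_inj (mulmxK U)); rewrite mul0mx.
    have /matrixP E := wker; apply/matrixP => k j; rewrite [RHS]mxE.
    have := E 0 j; rewrite [X in X = _ -> _]mxE [X in _ = X -> _]mxE => <-.
    rewrite (bigD1_ord ord_max) //= w1 mul0r add0r.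
    rewrite (bigD1_ord ord0) //= max0 w0 mul0r add0r mxE.
    by apply: eq_bigr => l _; rewrite !mxE.
  case: (unliftP ord_max i) => [k ->|->]; last by rewrite w1.
  case: (unliftP ord0 k) => [l ->|->]; last by rewrite max0.
  by have /matrixP/(_ 0 l) := w'0; rewrite !mxE.
have := w_eq0 p; rewrite wE -{2}p_max -{3}p_0 !ext_lift zE uE vE !inordK; try lia.
have -> : (-1) ^+ p = - (-1) ^+ p.-1 :> R by rewrite -[in LHS](prednK (n := p)) ?exprS ?mulN1r //; lia.
move=> E.
set A := \det (row' _ (row' ord_max N)) in E.
set B := \det (row' _ (row' ord0 N)) in E.
have -> : \det (row' p M) = a * A + b * B.
  have /mulfI : (-1) ^+ p.-1 != 0 :> R by rewrite signr_eq0.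
  apply; rewrite -[LHS]addr0 -[X in _ + X]E; ring.
by rewrite addr_gt0 // mulr_gt0 ?divr_gt0 // N_gt0.
Qed.
End SignedMinors.

(** * Fekete's criterion *)

Section Fekete.
Variable R : realFieldType.
Implicit Types (F : nat -> nat -> R) (f g : nat -> nat).

(** Arrays and index maps live on [nat], so that indices can be shifted, inserted and deleted
    freely; only the first [k] values of [f] and [g] matter. *)
Definition minor F k f g : R := \det (\matrix_(i < k, j < k) F (f i) (g j)).

Definition increasing_below k f := forall i j, (i < j < k)%N -> (f i < f j)%N.

Lemma increasing_below_succ k f :
  increasing_below k.+1 f -> increasing_below k (f \o succn).
Proof. by move=> f_incr i j ij; apply: f_incr; lia. Qed.

Lemma increasing_below_bump k c f :
  increasing_below k.+1 f -> increasing_below k (f \o bump c).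
Proof. by move=> f_incr i j ij; apply: f_incr; rewrite /bump; lia. Qed.

Lemma eq_minor F k f g f' g' :
  (forall i, (i < k)%N -> f i = f' i) -> (forall i, (i < k)%N -> g i = g' i) ->
  minor F k f g = minor F k f' g'.
Proof.
move=> ff' gg'; congr (\det _); apply/matrixP => i j.
by rewrite !mxE ff' ?gg'.
Qed.

Lemma minor_tr F k f g : minor F k f g = minor (fun i j => F j i) k g f.
Proof.
by rewrite /minor -det_tr; congr (\det _); apply/matrixP => i j; rewrite !mxE.
Qed.

(* Induction on the spread [f k - f 0]: a row inserted in a gap of [f] lies
   strictly between the first and the last one. *)
Lemma minor_gt0_of_contiguous_rows F n k g :
  (forall s, (s + k < n)%N -> 0 < minor F k.+1 (addn s) g) ->
  (forall f, increasing_below k f -> (forall i, (i < k)%N -> (f i < n)%N) ->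
     0 < minor F k f (g \o succn)) ->
  forall f, increasing_below k.+1 f -> (f k < n)%N -> 0 < minor F k.+1 f g.
Proof.
move=> contig smaller f; have [d] := ubnP (f k - f 0%N)%N.
elim: d f => // d IH f le_d f_incr f_lt.
have [/existsP[i0 gap]|] := boolP [exists i : 'I_k, f i.+1 != (f i).+1]; last first.
  rewrite negb_exists => /forallP consec.
  have f_shift i : (i < k.+1)%N -> f i = (f 0 + i)%N.
    elim: i => [|i IHi] ik; first by rewrite addn0.
    by have /negPn/eqP -> := consec (Ordinal (ik : (i < k)%N)); rewrite IHi; lia.
  rewrite (@eq_minor F k.+1 f g (addn (f 0%N)) g) //.
  by apply: contig; rewrite -f_shift.
(* [h] inserts the value [(f i0).+1] into the gap after index [i0]; deleting index [p = i0.+1] gives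
   [f] back. *)
pose h j := if (j <= i0)%N then f j else if j == i0.+1 then (f i0).+1 else f j.-1.
have i0k := ltn_ord i0.
have f_le i j : (i <= j <= k)%N -> (f i <= f j)%N.
  case/andP=> ij jk; have [->//|ne] := eqVneq i j.
  by apply/ltnW/f_incr; lia.
have gap_lt : ((f i0).+1 < f i0.+1)%N.
  by have := f_incr i0 i0.+1; move/eqP: gap; lia.
have h_incr : increasing_below k.+2 h.
  move=> i j /andP[ij jk]; rewrite /h.
  have [j_le|j_gt] := leqP j i0; first by rewrite ifT; [apply: f_incr; lia | lia].
  have [j_eq|j_neq] := eqVneq j i0.+1.
    by rewrite ifT ?ltnS; [apply: f_le; lia | lia].
  have [i_le|i_gt] := leqP i i0; first by apply: f_incr; lia.
  have [i_eq|i_neq] := eqVneq i i0.+1; last by apply: f_incr; lia.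
  by apply: (leq_trans gap_lt); apply: f_le; lia.
have f0k : (f 0 < f k)%N by apply: f_incr; lia.
have h0 : h 0%N = f 0%N by rewrite /h leq0n.
have hk : h k.+1 = f k.
  by rewrite /h ifF; [case: eqVneq => //; lia | lia].
have h_lt i : (i < k.+2)%N -> (h i < n)%N.
  move=> ik; apply: leq_ltn_trans f_lt; rewrite -hk.
  have [->//|ne] := eqVneq i k.+1.
  by apply/ltnW/h_incr; lia.
pose p : 'I_k.+2 := inord i0.+1.
have pE : p = i0.+1 :> nat by rewrite inordK; lia.
pose M := \matrix_(i < k.+2, j < k.+1) F (h i) (g j).
have minorE (c : 'I_k.+2) : \det (row' c M) = minor F k.+1 (h \o bump c) g.
  by congr (\det _); apply/matrixP => i j; rewrite !mxE.
have -> : minor F k.+1 f g = minor F k.+1 (h \o bump p) g.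
  apply: eq_minor => // i ik; rewrite /= /bump pE /h.
  have [ile|igt] := leqP i0.+1 i; last by rewrite add0n ifT; lia.
  by rewrite add1n ifF ?ifF //; lia.
rewrite -minorE; apply: det_row'_interior_gt0.
- by rewrite pE; lia.
- move=> c i.
  have -> : \det (row' i (row' c (col' ord0 M)))
            = minor F k (h \o bump c \o bump i) (g \o succn).
    by congr (\det _); apply/matrixP => u v; rewrite !mxE.
  apply: smaller; first by do 2 apply: increasing_below_bump.
  by move=> j jk /=; apply: h_lt; rewrite /bump; lia.
(* Deleting the first row of [h], or the last one below, strictly shrinks the spread. *)
- rewrite minorE; apply: IH.
  + have := h_incr 0%N 1%N isT; have -> : (h \o bump (@ord0 k.+1)) k = h k.+1 by [].
    by have -> : (h \o bump (@ord0 k.+1)) 0%N = h 1%N by []; rewrite hk h0; lia.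
  + exact: increasing_below_bump.
  + by rewrite /=; apply: h_lt; rewrite /bump; lia.
- rewrite minorE.
  have E i : (i < k.+1)%N -> (h \o bump (@ord_max k.+1)) i = h i.
    by move=> ik; rewrite /= /bump /= leqNgt ik.
  rewrite (eq_minor _ E (fun _ _ => erefl)); apply: IH.
  + have := h_incr k k.+1; rewrite hk h0; lia.
  + by move=> i j ij; apply: h_incr; lia.
  + by apply: h_lt.
Qed.

(** The previous lemma is used twice: on the transpose, to reduce to contiguous columns, then on [F]
    itself, to reduce to contiguous rows. Induction on [k] supplies the smaller minors it asks
    for. *)
Lemma fekete F n k :
  (forall l s t, (l <= k)%N -> (s + l <= n)%N -> (t + l <= n)%N ->
     0 < minor F l (addn s) (addn t)) ->
  forall f g, increasing_below k f -> increasing_below k g ->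
  (forall i, (i < k)%N -> (f i < n)%N) -> (forall i, (i < k)%N -> (g i < n)%N) ->
  0 < minor F k f g.
Proof.
elim: k => [|k IH] contig f g f_incr g_incr f_lt g_lt.
  by rewrite /minor det_mx00.
have {}IH := IH (fun l s t lk => contig l s t (leqW lk)).
rewrite minor_tr; apply: (@minor_gt0_of_contiguous_rows _ n) => //; last exact: g_lt.
- move=> t tk; rewrite -minor_tr.
  apply: (@minor_gt0_of_contiguous_rows _ n) => //; last exact: f_lt.
  + by move=> s sk; apply: contig => //; lia.
  + move=> h h_incr h_lt; apply: IH => //.
    * by move=> i j ij /=; lia.
    * by move=> i ik /=; lia.
- move=> h h_incr h_lt; rewrite -minor_tr; apply: IH => //.
  + exact: increasing_below_succ.
  + by move=> i ik /=; apply: f_lt.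
Qed.
End Fekete.

(** * Quadratic forms, Schur complements and definiteness *)

Section QuadraticForms.
Variable R : realFieldType.

Definition qform k (M : 'M[R]_k) (x : 'rV[R]_k) : R := (x *m M *m x^T) 0 0.

Definition psd k (M : 'M[R]_k) := forall x, 0 <= qform M x.

Definition pd k (M : 'M[R]_k) := forall x, x != 0 -> 0 < qform M x.

Lemma qformDl k (M N : 'M[R]_k) x : qform (M + N) x = qform M x + qform N x.
Proof. by rewrite /qform mulmxDr mulmxDl mxE. Qed.

Lemma qformZl k (a : R) (M : 'M[R]_k) x : qform (a *: M) x = a * qform M x.
Proof. by rewrite /qform -scalemxAr -scalemxAl mxE. Qed.

Lemma psd_add_pd k (M N : 'M[R]_k) : psd M -> pd N -> pd (M + N).
Proof. by move=> psdM pdN x x0; rewrite qformDl ltr_wpDl ?pdN. Qed.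

Lemma psd_add k (M N : 'M[R]_k) : psd M -> psd N -> psd (M + N).
Proof. by move=> psdM psdN x; rewrite qformDl addr_ge0. Qed.

Lemma pd_scale k (a : R) (M : 'M[R]_k) : 0 < a -> pd M -> pd (a *: M).
Proof. by move=> a0 pdM x x0; rewrite qformZl mulr_gt0 ?pdM. Qed.

Definition schur k (M : 'M[R]_(1 + k)) : 'M[R]_k :=
  drsubmx M - (M 0 0)^-1 *: (dlsubmx M *m ursubmx M).

Definition schur_unit k (M : 'M[R]_(1 + k)) : 'M[R]_(1 + k) :=
  block_mx 1%:M 0 ((M 0 0)^-1 *: dlsubmx M) 1%:M.

Lemma det_schur_unit k (M : 'M[R]_(1 + k)) : \det (schur_unit M) = 1.
Proof. by rewrite det_lblock !det1 mulr1. Qed.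

Lemma ulsubmx1 k (M : 'M[R]_(1 + k)) : ulsubmx M = (M 0 0)%:M.
Proof. by rewrite [LHS]mx11_scalar !mxE; congr (M _ _)%:M; apply: val_inj. Qed.

Lemma schurE k (M : 'M[R]_(1 + k)) : M 0 0 != 0 ->
  M = schur_unit M *m block_mx (M 0 0)%:M (ursubmx M) 0 (schur M).
Proof.
move=> M0; rewrite -[LHS]submxK ulsubmx1 mulmx_block !mul1mx !mul0mx ?mulmx0 !addr0.
rewrite mul_mx_scalar scalerA mulfV // scale1r.
by rewrite /schur -scalemxAl addrC subrK.
Qed.

Lemma det_schur k (M : 'M[R]_(1 + k)) : M 0 0 != 0 ->
  \det M = M 0 0 * \det (schur M).
Proof.
move=> M0; rewrite {1}(schurE M0) det_mulmx det_schur_unit mul1r.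
by rewrite det_ublock det_scalar1.
Qed.

Lemma trmx_ursubmx_sym k (M : 'M[R]_(1 + k)) : M^T = M -> (ursubmx M)^T = dlsubmx M.
Proof. by move=> symM; rewrite trmx_ursub symM. Qed.

Lemma schur_sym k (M : 'M[R]_(1 + k)) : M^T = M -> (schur M)^T = schur M.
Proof.
move=> symM; rewrite /schur !linearB /= !linearZ /= trmx_mul trmx_drsub symM.
by rewrite trmx_ursubmx_sym // trmx_dlsub symM.
Qed.

(** One step of symmetric Gaussian elimination: [M = L D L^T] with [D] block diagonal, and the
    change of variables by [invmx L] leaves the form of [D]. *)
Lemma qform_schur k (M : 'M[R]_(1 + k)) u y : M^T = M -> M 0 0 != 0 ->
  qform M (row_mx u%:M y *m invmx (schur_unit M)) = M 0 0 * u ^+ 2 + qform (schur M) y.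
Proof.
move=> symM M0; set L := schur_unit M.
have unitL : L \in unitmx by rewrite unitmxE det_schur_unit unitr1.
have LDL : M = L *m block_mx (M 0 0)%:M 0 0 (schur M) *m L^T.
  rewrite {1}(schurE M0) -mulmxA; congr (_ *m _).
  rewrite tr_block_mx mulmx_block !trmx1 !trmx0 !mulmx1 !mul0mx !mulmx0 !addr0 !add0r.
  rewrite linearZ /= trmx_dlsub symM -scalemxAr mul_scalar_mx scalerA.
  by rewrite mulVf // scale1r.
rewrite /qform {1}LDL trmx_mul trmx_inv -!mulmxA (mulmxA (invmx L)) mulVmx // mul1mx.
rewrite (mulmxA L^T) mulmxV ?unitmx_tr // mul1mx.
rewrite tr_row_mx mul_block_col !mul0mx addr0 add0r mul_row_col mxE.
congr (_ + _).
  by rewrite tr_scalar_mx -!scalar_mxM mxE eqxx mulr1n mulrCA.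
Qed.

Lemma qform_schurE k (M : 'M[R]_(1 + k)) x : M^T = M -> M 0 0 != 0 ->
  exists u y, qform M x = M 0 0 * u ^+ 2 + qform (schur M) y.
Proof.
move=> symM M0; set z := x *m schur_unit M.
exists (lsubmx z 0 0), (rsubmx z); rewrite -qform_schur // -mx11_scalar hsubmxK.
by rewrite mulmxK // unitmxE det_schur_unit unitr1.
Qed.

Lemma qform_delta k (M : 'M[R]_k) i : qform M (delta_mx 0 i) = M i i.
Proof.
by rewrite /qform -rowE trmx_delta -colE !mxE.
Qed.

Lemma qform_block0 k (S : 'M[R]_k) (x : 'rV[R]_(1 + k)) :
  qform (block_mx 0 0 0 S) x = qform S (rsubmx x).
Proof.
rewrite /qform -{1 2}[x]hsubmxK tr_row_mx mul_row_block mul_row_col.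
by rewrite !mulmx0 !add0r mul0mx add0r.
Qed.

(** The determinant is the corner entry times that of the Schur complement, which is again positive
    definite by [qform_schur] at [u = 0]. *)
Lemma pd_det_gt0 k (M : 'M[R]_k) : M^T = M -> pd M -> 0 < \det M.
Proof.
elim: k M => [|k IH] M symM pdM; first by rewrite det_mx00.
have M0 : 0 < M 0 0.
  rewrite -qform_delta; apply: pdM; apply/eqP => /matrixP/(_ 0 0).
  by rewrite !mxE !eqxx => /eqP; rewrite oner_eq0.
have Mn0 : M 0 0 != 0 by rewrite gt_eqF.
rewrite (@det_schur k M) // mulr_gt0 // IH ?(@schur_sym k M) // => y y0.
have := @qform_schur k M 0 y symM Mn0.
rewrite expr0n mulr0 add0r => <-; apply: pdM.
apply: contraNneq y0 => /(congr1 (mulmx^~ (schur_unit M))).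
rewrite mulmxKV ?unitmxE ?det_schur_unit ?unitr1 // mul0mx.
by rewrite -[RHS]row_mx0 => /eq_row_mx[_ ->].
Qed.

Lemma schur_mxsub k m (M : 'M[R]_(1 + k)) (f : 'I_m -> 'I_k) (f' : 'I_(1 + m) -> 'I_(1 + k)) :
  f' 0 = 0 -> (forall i, f' (rshift 1 i) = rshift 1 (f i)) ->
  schur (mxsub f' f' M) = mxsub f f (schur M).
Proof.
move=> f'0 f'S; apply/matrixP => i j.
have l0 p : lshift p (0 : 'I_1) = 0 :> 'I_(1 + p) by apply: val_inj.
rewrite !mxE f'0 !f'S; congr (_ - _ * _).
by apply: eq_bigr => l _; rewrite !mxE !f'S ord1 !l0 f'0.
Qed.

(* Schur complementation at a nonzero corner; a zero corner forces its whole
   row to vanish, by the 2 x 2 principal minors. *)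
Lemma psd_of_principal_minors k (M : 'M[R]_k) : M^T = M ->
  (forall m (f : 'I_m -> 'I_k), strictly_increasing f -> 0 <= \det (mxsub f f M)) ->
  psd M.
Proof.
elim: k M => [|k IH] M symM minors x.
  by rewrite /qform mxE big_ord0.
have symE i j : M i j = M j i by rewrite -[in LHS]symM mxE.
have M0 : 0 <= M 0 0.
  have := minors 1%N (fun=> 0); rewrite det_mx11 mxE; apply => i j.
  by rewrite !ord1.
have [M00|Mn0] := eqVneq (M 0 0) 0.
  have row0 j : M 0 j = 0.
    case: (unliftP 0 j) => [l ->|->] //.
    pose f (i : 'I_2) := if i == 0 then 0 else lift 0 l.
    have f_incr : strictly_increasing f by move=> [[|[|i]] ?] [[|[|j']] ?].
    have := minors _ _ f_incr.
    rewrite (expand_det_row _ 0) !big_ord_recl big_ord0 /cofactor !det_mx11 !mxE.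
    rewrite /f /= M00 mul0r add0r addr0 expr1 (symE (lift 0 l)).
    rewrite mulN1r mulrN oppr_ge0 -expr2 => sq_le0.
    by apply/eqP; rewrite -sqrf_eq0 eq_le sq_le0 sqr_ge0.
  have psdS : psd (drsubmx (M : 'M_(1 + k))).
    apply: IH => [|m f f_incr]; first by rewrite trmx_drsub symM.
    have -> : mxsub f f (drsubmx (M : 'M_(1 + k))) =
              mxsub (@rshift 1 k \o f) (@rshift 1 k \o f) M.
      by apply/matrixP => i j; rewrite !mxE.
    by apply: minors => i j ij; rewrite /= ltn_add2l f_incr.
  suff -> : qform M x = qform (drsubmx (M : 'M_(1 + k))) (rsubmx (x : 'rV_(1 + k))) by [].
  have -> : M = block_mx 0 0 0 (drsubmx (M : 'M_(1 + k))) :> 'M_(1 + k).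
    have l0 (i : 'I_1) : lshift k i = 0 by apply: val_inj; rewrite ord1.
    rewrite -[LHS](@submxK _ 1 k 1 k); congr block_mx;
      by apply/matrixP => i j; rewrite !mxE ?l0 ?row0 // symE row0.
  by rewrite qform_block0 block_mxKdr.
have [u [y ->]] := @qform_schurE k M x symM Mn0.
apply: addr_ge0; first by rewrite mulr_ge0 ?sqr_ge0 //.
apply: (IH (schur (M : 'M_(1 + k)))) => [|m f f_incr].
  exact: (@schur_sym k M).
(* Prepending index 0 to [f] makes the principal minor of [M] on [f'] equal to the positive corner
   times the minor of the Schur complement on [f]. *)
pose f' (i : 'I_(1 + m)) : 'I_(1 + k) := oapp (@rshift 1 k \o f) 0 (unlift 0 i).
have f'0 : f' 0 = 0 by rewrite /f' unlift_none.
have f'S i : f' (rshift 1 i) = rshift 1 (f i) by rewrite /f' rshift1 liftK.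
have f'_incr : strictly_increasing f'.
  move=> i j; rewrite /f'; case: (unliftP 0 i) => [i' ->|->];
    case: (unliftP 0 j) => [j' ->|->] //=.
  by rewrite /bump /= !add1n !ltnS; apply: f_incr.
have := minors _ f' f'_incr.
rewrite (@det_schur m) !mxE f'0 // (@schur_mxsub k m M f f') //.
by rewrite pmulr_rge0 // lt_neqAle eq_sym Mn0.
Qed.

(** If the form vanishes at [x], then with [y = x M] its value at [u x + y] is affine in [u] with
    slope twice the squared norm of [y]. Nonnegativity for all [u] forces [y = 0], hence [x = 0]. *)
Lemma psd_unit_pd k (M : 'M[R]_k) : M^T = M -> psd M -> M \in unitmx -> pd M.
Proof.
move=> symM psdM unitM x x0; rewrite lt_neqAle psdM andbT eq_sym.
apply: contraNneq x0 => qx0; pose y := x *m M.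
have dotE (z : 'rV[R]_k) : (z *m z^T) 0 0 = \sum_i z 0 i ^+ 2.
  by rewrite mxE; apply: eq_bigr => i _; rewrite mxE.
have expand u : qform M (u *: x + y) = u * (y *m y^T) 0 0 *+ 2 + qform M y.
  have xMy : x *m M *m y^T = y *m y^T by [].
  have yMx : y *m M *m x^T = y *m y^T by rewrite -mulmxA -{1}symM -trmx_mul.
  rewrite /qform linearD linearZ /= !mulmxDl !mulmxDr -!scalemxAl -!scalemxAr.
  have xMx : x *m M *m x^T = 0 by apply/matrixP => i j; rewrite !ord1 [RHS]mxE.
  rewrite xMx xMy yMx !scaler0 add0r addrA -scalerDl mxE [X in X + _]mxE.
  by rewrite mulr2n mulrDl.
have y0 : (y *m y^T) 0 0 = 0.
  apply/eqP/negPn/negP => ne0.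
  (* At this [u] the form would equal [- qform M y - 2], which is negative. *)
  have := psdM (- (qform M y + 1) / (y *m y^T) 0 0 *: x + y).
  by rewrite expand divfK //; have := psdM y; lra.
have {}y0 : y = 0.
  apply/matrixP => i j; rewrite ord1 [RHS]mxE; apply/eqP; rewrite -sqrf_eq0.
  have /eqP := y0; rewrite dotE psumr_eq0 => [/allP/(_ j)|l _]; last exact: sqr_ge0.
  by rewrite mem_index_enum => /(_ isT).
by rewrite -(mulmxK unitM x) -/y y0 mul0mx.
Qed.
End QuadraticForms.

(** * Passing to the limit in determinant inequalities *)

Section Limits.
Variable R : realFieldType.

Lemma horner0_ge0 (p : {poly R}) : (forall e, 0 < e -> 0 <= p.[e]) -> 0 <= p.[0].
Proof.
move=> p_ge0; rewrite leNgt; apply/negP => p0_lt0.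
have [q pE] : exists q, p = q * 'X + (p.[0])%:P.
  have /factor_theorem[q qE] : root (p - (p.[0])%:P) 0.
    by rewrite /root !hornerE subrr.
  by exists q; move: qE; rewrite subr0 => <-; rewrite subrK.
have [b qb] := poly_itv_bound q 0 1.
(* Since [q] is bounded by [b] on [[0, 1]], this [e] gives [e * q.[e] <= - p.[0] / 2], so [p.[e] <=
   p.[0] / 2 < 0]. *)
pose e := Num.min 1 (- p.[0] / (`|b| + 1) / 2).
have e_gt0 : 0 < e.
  by rewrite lt_min ltr01 !divr_gt0 ?oppr_gt0 // ltr_wpDl.
have := p_ge0 e e_gt0.
have e_le1 : e <= 1 by rewrite ge_min lexx.
have e_le : e * (`|b| + 1) <= - p.[0] / 2.
  rewrite -ler_pdivlMr ?ltr_wpDl // ge_min; apply/orP; right.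
  by rewrite mulrAC.
have /qb/(le_trans (ler_norm _)) q_le : 0 <= e <= 1 by rewrite ltW.
have : e * q.[e] <= e * (`|b| + 1).
  rewrite ler_pM2l // (le_trans q_le) // (le_trans (ler_norm b)) // lerDl //.
rewrite [in p.[e]]pE hornerD hornerM hornerX hornerC; lra.
Qed.

Lemma det_ge0_limit k (X Y : 'M[R]_k) :
  (forall e, 0 < e -> 0 <= \det (X + e *: Y)) -> 0 <= \det X.
Proof.
move=> XY; pose p := \det (map_mx polyC X + 'X *: map_mx polyC Y).
have pE e : p.[e] = \det (X + e *: Y).
  rewrite -[LHS]/(horner_eval e p) -det_map_mx; congr (\det _).
  apply/matrixP => i j; rewrite !mxE.
  by rewrite -[LHS]/(((X i j)%:P + 'X * (Y i j)%:P).[e]) !hornerE.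
have := @horner0_ge0 p; rewrite pE scale0r addr0; apply => e e_gt0.
by rewrite pE XY.
Qed.
End Limits.

(** * Contiguous blocks of Hankel matrices *)

Section HankelBlocks.
Variables (R : realType) (n : nat).
Implicit Types A B : 'M[R]_n.+1.

Lemma strictly_increasing_inj k m (f : 'I_k -> 'I_m) :
  strictly_increasing f -> injective f.
Proof.
move=> f_incr i j fij; apply/val_inj; case: (ltngtP i j) => // /f_incr;
  by rewrite fij ltnn.
Qed.

(** [inord] sends out-of-range indices to 0, so this is a genuine block only when [s + k] and
    [t + k] are at most [n.+1]. *)
Definition contiguous_block A s t k : 'M[R]_k :=
  mxsub (fun i : 'I_k => inord (s + i)) (fun j : 'I_k => inord (t + j)) A.

Lemma hankelD A B : hankel A -> hankel B -> hankel (A + B).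
Proof. by move=> hA hB i j i' j' ij; rewrite !mxE (hA _ _ _ _ ij) (hB _ _ _ _ ij). Qed.

Lemma hankelZ (a : R) A : hankel A -> hankel (a *: A).
Proof. by move=> hA i j i' j' ij; rewrite !mxE (hA _ _ _ _ ij). Qed.

Section Block.
Variables s t k : nat.
Hypotheses (sk : (s + k <= n.+1)%N) (tk : (t + k <= n.+1)%N).

Lemma contiguous_block_sym A : hankel A ->
  (contiguous_block A s t k)^T = contiguous_block A s t k.
Proof.
move=> hA; apply/matrixP => i j; rewrite !mxE; apply: hA.
by have ik := ltn_ord i; have jk := ltn_ord j; rewrite !inordK; lia.
Qed.

Lemma contiguous_rows_incr m (f : 'I_m -> 'I_k) :
  strictly_increasing f -> forall u, (u + k <= n.+1)%N ->
  strictly_increasing (fun i => inord (u + f i) : 'I_n.+1).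
Proof.
move=> f_incr u uk i j /f_incr ij.
by have ik := ltn_ord (f i); have jk := ltn_ord (f j); rewrite /= !inordK; lia.
Qed.

(** A principal minor of the block is a minor of [A], with rows shifted by [s] and columns by [t],
    and its size is at most [k]. *)
Lemma tn_block_psd A r : hankel A -> totally_nonnegative r A -> (k <= r)%N ->
  psd (contiguous_block A s t k).
Proof.
move=> hA tnA kr; apply: psd_of_principal_minors; first exact: contiguous_block_sym.
(* The empty minor is treated apart: total nonnegativity only speaks of positive sizes. *)
move=> [|m] f f_incr; first by rewrite det_mx00 ler01.
have mk : (m.+1 <= k)%N.
  by have := leq_card _ (strictly_increasing_inj f_incr); rewrite !card_ord.
rewrite /contiguous_block -mxsub_comp.
by apply: tnA; [lia | apply: contiguous_rows_incr..].
Qed.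

Lemma tp_block_pd A r : hankel A -> totally_positive r A -> (k <= r)%N ->
  pd (contiguous_block A s t k).
Proof.
move=> hA tpA kr; apply: psd_unit_pd; first exact: contiguous_block_sym.
  by apply: (tn_block_psd hA _ kr) => m f g mr f_incr g_incr; apply/ltW/tpA.
rewrite unitmxE unitfE gt_eqF //; case: (posnP k) => [k0|k0].
  by clear sk tk; subst k; rewrite det_mx00 ltr01.
apply: tpA; first by rewrite k0.
  exact: (@contiguous_rows_incr k id).
exact: (@contiguous_rows_incr k id).
Qed.

End Block.

Lemma tp_of_blocks_pd A r : hankel A ->
  (forall k s t, (k <= r)%N -> (s + k <= n.+1)%N -> (t + k <= n.+1)%N ->
     pd (contiguous_block A s t k)) ->
  totally_positive r A.
Proof.
move=> hA pdA [|k] f g // /andP[_ kr] f_incr g_incr.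
pose ext (h : 'I_k.+1 -> 'I_n.+1) i : nat := h (inord i).
have ext_incr h : strictly_increasing h -> increasing_below k.+1 (ext h).
  by move=> h_incr i j ij; apply: h_incr; rewrite !inordK; lia.
have -> : \det (mxsub f g A) =
    minor (fun i j => A (inord i) (inord j)) k.+1 (ext f) (ext g).
  by congr (\det _); apply/matrixP => i j; rewrite !mxE /ext !inord_val.
apply: (@fekete _ _ n.+1) => [|||i _|i _]; [|exact: ext_incr|exact: ext_incr|exact: ltn_ord|exact: ltn_ord].
move=> l s t lk sl tl; have := contiguous_block_sym sl tl hA.
by move=> /pd_det_gt0; apply; apply: pdA => //; lia.
Qed.

(* The moment matrix of the counting measure on [1, ..., n.+1]: a nonzero
   polynomial of degree at most [n] cannot vanish on this support. *)
Definition power_sum_hankel : 'M[R]_n.+1 :=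
  \matrix_(i, j) \sum_(l < n.+1) l.+1%:R ^+ (i + j).

Lemma power_sum_hankel_hankel : hankel power_sum_hankel.
Proof. by move=> i j i' j' ij; rewrite !mxE ij. Qed.

Lemma power_sum_block_pd s t k : (s + k <= n.+1)%N -> (t + k <= n.+1)%N ->
  pd (contiguous_block power_sum_hankel s t k).
Proof.
move=> sk tk x x0; pose p := rVpoly x.
have pE a : p.[a] = \sum_(i < k) x 0 i * a ^+ i.
  by rewrite horner_poly; apply: eq_bigr => i _; rewrite valK.
have p0 : p != 0.
  by apply: contraNneq x0 => p0; rewrite -(rVpolyK x) -/p p0 linear0.
(* The offsets contribute only the weight [l.+1%:R ^+ (s + t)], which is positive because the nodes
   start at 1 and not at 0. *)
have -> : qform (contiguous_block power_sum_hankel s t k) x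
          = \sum_(l < n.+1) l.+1%:R ^+ (s + t) * p.[l.+1%:R] ^+ 2.
  rewrite /qform mxE.
  transitivity (\sum_(j < k) \sum_(i < k) \sum_(l < n.+1)
    l.+1%:R ^+ (s + t) * ((x 0 i * l.+1%:R ^+ i) * (x 0 j * l.+1%:R ^+ j))).
    apply: eq_bigr => j _; rewrite !mxE mulr_suml; apply: eq_bigr => i _.
    rewrite !mxE mulr_sumr mulr_suml; apply: eq_bigr => l _.
    have ik := ltn_ord i; have jk := ltn_ord j.
    by rewrite !inordK ?exprD; [ring | lia | lia].
  under eq_bigr do rewrite exchange_big /=.
  rewrite exchange_big /=; apply: eq_bigr => l _.
  rewrite expr2 pE mulr_suml mulr_sumr exchange_big /=; apply: eq_bigr => i _.
  by rewrite !mulr_sumr.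
have term_ge0 (l : 'I_n.+1) : 0 <= l.+1%:R ^+ (s + t) * p.[l.+1%:R] ^+ 2.
  by rewrite mulr_ge0 ?sqr_ge0 // exprn_ge0.
rewrite lt_neqAle sumr_ge0 // andbT eq_sym; apply/negP.
rewrite psumr_eq0 // => /allP all0.
pose rs : seq R := [seq (l : 'I_n.+1).+1%:R | l <- enum 'I_n.+1].
have rs_root : all (root p) rs.
  apply/allP => _ /mapP[l _ ->]; have := all0 l; rewrite mem_index_enum => /(_ isT) /=.
  by rewrite mulf_eq0 expf_eq0 pnatr_eq0 andbF sqrf_eq0.
have rs_uniq : uniq rs.
  rewrite map_inj_uniq ?enum_uniq // => l m /eqP.
  by rewrite eqr_nat eqSS => /eqP/val_inj.
have := max_poly_roots p0 rs_root rs_uniq; rewrite size_map size_enum_ord.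
have size_p : (size p <= k)%N := size_poly _ _.
have kn : (k <= n.+1)%N by lia.
by rewrite ltnNge (leq_trans size_p kn).
Qed.

End HankelBlocks.

Theorem corollary3p3 (R : realType) (n r : nat) (hn : (1 <= n)%N) (hr : (1 <= r)%N) :
  (forall A B : 'M[R]_n,
      hankel A -> hankel B ->
      totally_nonnegative r A -> totally_nonnegative r B ->
      totally_nonnegative r (A + B)) /\
  (forall A B : 'M[R]_n,
      hankel A -> hankel B ->
      totally_nonnegative r A -> totally_positive r B ->
      totally_positive r (A + B)).
Proof.
case: n hn => // n _; split=> A B hA hB tnA.
  move=> tnB k f g kr f_incr g_incr.
  apply: (@det_ge0_limit _ _ _ (mxsub f g (power_sum_hankel R n))) => e e_gt0.
  have -> : mxsub f g (A + B) + e *: mxsub f g (power_sum_hankel R n)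
            = mxsub f g (A + B + e *: power_sum_hankel R n).
    by apply/matrixP => i j; rewrite !mxE.
  apply/ltW; move: kr f_incr g_incr; apply: tp_of_blocks_pd.
    apply: hankelD; first exact: hankelD.
    exact/hankelZ/power_sum_hankel_hankel.
  move=> l s t lr sl tl.
  rewrite /contiguous_block !linearD linearZ /=; apply: psd_add_pd.
    by apply: psd_add; apply: tn_block_psd lr.
  exact/pd_scale/power_sum_block_pd.
move=> tpB; apply: tp_of_blocks_pd; first exact: hankelD.
move=> l s t lr sl tl; rewrite /contiguous_block linearD /=.
by apply: psd_add_pd; [apply: tn_block_psd lr | apply: tp_block_pd lr].
Qed.
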